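(* Let $0<p<1$ and $0<\varepsilon<1$, and let $\mathbb{Q}$ be the law on $\{-1,1\}^{\mathbb{Z}_+}$ of the hidden Markov process $Y_n=X_n\cdot Z_n$, where $\{X_n\}$ is the stationary symmetric $\{\pm1\}$-valued Markov chain with $\mathbb{P}(X_{n+1}\neq X_n)=p$ and $\{Z_n\}$ is an independent i.i.d. sequence with $\mathbb{P}_Z(Z_n=-1)=\varepsilon$, $\mathbb{P}_Z(Z_n=1)=1-\varepsilon$. Then: (1) $\mathbb{Q}$ is a $g$-measure for some positive continuous function $g:\{-1,1\}^{\mathbb{Z}_+}\to(0,1)$ with exponential decay of variation: there exist constants $C>0$ and $\rho\in(0,1)$ such that for all $n\ge 1$ $$\mathrm{var}_n(g):=\sup\bigl\{|g(\boldsymbol{y})-g(\tilde{\boldsymbol{y}})| : \boldsymbol{y},\tilde{\boldsymbol{y}}\in\{-1,1\}^{\mathbb{Z}_+},\ y_i=\tilde y_i \text{ for } 0\le i\le n-1\bigr\}\le C\rho^n .$$ (2) $\mathbb{Q}$ is a Bowen-Gibbs measure for some Hölder continuous potential $\phi:\{-1,1\}^{\mathbb{Z}_+}\to\mathbb{R}$.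
   Context: $\mathbb{Z}_+=\{0,1,2,\dots\}$. The chain $\{X_n\}$ has uniform stationary distribution and transition probabilities $p_{x,x'}=p$ if $x\ne x'$ and $1-p$ if $x=x'$. Explicitly, for $y_0,\dots,y_n\in\{-1,1\}$, $$\mathbb{Q}(Y_0=y_0,\dots,Y_n=y_n)=\sum_{x_0,\dots,x_n\in\{-1,1\}}\frac12\prod_{i=0}^{n-1}p_{x_i,x_{i+1}}\cdot \varepsilon^{\#\{0\le i\le n:\,x_iy_i=-1\}}(1-\varepsilon)^{\#\{0\le i\le n:\,x_iy_i=1\}} .$$ Let $\Omega=A^{\mathbb{Z}_+}$ with $A$ a finite alphabet (here $A=\{-1,1\}$), with left shift $S:\Omega\to\Omega$, $(S\boldsymbol\omega)_i=\omega_{i+1}$, and metric $d(\boldsymbol\omega,\tilde{\boldsymbol\omega})=2^{-k(\boldsymbol\omega,\tilde{\boldsymbol\omega})}$ for $\boldsymbol\omega\neq\tilde{\boldsymbol\omega}$ (and $0$ if they are equal), where $k=1$ if $\omega_0\ne\tilde\omega_0$ and otherwise $k=\max\{k\in\mathbb{N}:\omega_i=\tilde\omega_i\ \forall\, 0\le i\le k-1\}$. Continuity and Hölder continuity are with respect to $d$. A fully supported translation invariant Borel probability measure $\mathbb{P}$ on $\Omega$ is a $g$-measure if, for some positive continuous $g:\Omega\to(0,1)$ with $\sum_{\bar\omega_0\in A}g(\bar\omega_0,\omega_1,\omega_2,\dots)=1$ for all $\boldsymbol\omega\in\Omega$, one has $\mathbb{P}(\omega_0\mid\omega_1,\omega_2,\dots)=g(\omega_0,\omega_1,\dots)$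 for $\mathbb{P}$-a.a. $\boldsymbol\omega$. Such a measure $\mathbb{P}$ is Bowen-Gibbs for a continuous potential $\phi:\Omega\to\mathbb{R}$ if there exist $P\in\mathbb{R}$ and $C\ge1$ such that for all $\boldsymbol\omega\in\Omega$ and all $n\in\mathbb{N}$, $n\ge 1$, $$\frac1C\le\frac{\mathbb{P}(\{\tilde{\boldsymbol\omega}:\tilde\omega_0=\omega_0,\dots,\tilde\omega_{n-1}=\omega_{n-1}\})}{\exp\bigl(\sum_{k=0}^{n-1}\phi(S^k\boldsymbol\omega)-nP\bigr)}\le C .$$ *)

(* Defs.v *)
From HB Require Import structures.
From mathcomp Require Import all_boot all_order all_algebra.
From mathcomp Require Import all_classical all_reals all_analysis.

Set Implicit Arguments.
Unset Strict Implicit.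
Unset Printing Implicit Defensive.

Import Order.TTheory GRing.Theory Num.Theory.
Import numFieldNormedType.Exports.

Local Open Scope classical_set_scope.
Local Open Scope ring_scope.

(* The alphabet {-1, 1}, as a finite subtype of int; [val] is the inclusion. *)
Definition spin : Type := seq_sub [:: -1; 1 : int].

HB.instance Definition _ := Finite.on spin.

Definition spin_neg : spin := SeqSub (mem_head (-1) [:: 1 : int]).
Definition spin_pos : spin := SeqSub (mem_last (-1) [:: 1 : int]).

HB.instance Definition _ := isPointed.Build spin spin_pos.

HB.instance Definition _ := @isMeasurable.Build default_measure_display
  spin [set: set spin] I (fun _ _ => I) (fun _ _ => I).

(* The space {-1, 1}^{Z_+}. The parameter R is the field in which the metric
   takes its values. *)
Definition Omega (R : realType) : Type := nat -> spin.

HB.instance Definition _ (R : realType) := Pointed.on (Omega R).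

Definition left_shift (R : realType) (w : Omega R) : Omega R := fun i => w i.+1.

Definition scons (R : realType) (a : spin) (w : Omega R) : Omega R :=
  fun i => if i is j.+1 then w j else a.

Definition agree (R : realType) (n : nat) (w w' : Omega R) : Prop :=
  forall i, (i < n)%N -> w i = w' i.

(* Meaningful for w != w' only: otherwise the maximum does not exist. *)
Definition sep_index (R : realType) (w w' : Omega R) : nat :=
  if w 0%N == w' 0%N then
    xget 1%N [set k | agree k w w' /\ forall j, agree j w w' -> (j <= k)%N]
  else 1%N.

Definition Omega_dist (R : realType) (w w' : Omega R) : R :=
  if w == w' then 0 else 2 ^- sep_index w w'.

Section metric.
Variable R : realType.
Implicit Types u v w : Omega R.

Lemma agree_sym n v w : agree n v w -> agree n w v.
Proof. by move=> a i /a. Qed.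

Lemma sep_indexC v w : sep_index v w = sep_index w v.
Proof.
rewrite /sep_index eq_sym; case: ifP => // _; congr xget.
by apply/seteqP; split=> k [/agree_sym ak H]; split=> // j /agree_sym; exact: H.
Qed.

Lemma distxx w : Omega_dist w w = 0.
Proof. by rewrite /Omega_dist eqxx. Qed.

Lemma dist_eq0 v w : Omega_dist v w = 0 -> v = w.
Proof.
rewrite /Omega_dist; case: eqP => // _ /eqP.
by rewrite invr_eq0 expf_eq0 pnatr_eq0 andbF.
Qed.

Lemma distC v w : Omega_dist v w = Omega_dist w v.
Proof. by rewrite /Omega_dist eq_sym sep_indexC. Qed.

Lemma sep_indexP v w : v != w ->
  exists2 m, agree m v w /\ v m != w m & sep_index v w = maxn 1 m.
Proof.
move=> vw; have ex : exists m, v m != w m.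
  apply: contrapT => H; move/eqP: vw; apply; apply/funext => m.
  by apply/eqP; apply: contrapT => /negP ?; apply: H; exists m.
case: (ex_minnP ex) => m dm minm; exists m.
  split=> // i im; apply/eqP; apply: contraTT im => /minm.
  by rewrite -leqNgt.
rewrite /sep_index; case: ifPn => [e0|n0]; last first.
  by move/minm: n0; rewrite leqn0 => /eqP ->.
have m0 : (0 < m)%N by case: m dm {minm} => //; rewrite e0.
rewrite (maxn_idPr m0); apply: xget_unique => [|k [ak kmax]].
  split=> [i im|j aj].
    by apply/eqP; apply: contraTT im => /minm; rewrite -leqNgt.
  by rewrite leqNgt; apply/negP => /aj /eqP; rewrite (negbTE dm).
apply/eqP; rewrite eqn_leq; apply/andP; split.
  by rewrite leqNgt; apply/negP => /ak /eqP; rewrite (negbTE dm).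
apply: kmax => i im.
by apply/eqP; apply: contraTT im => /minm; rewrite -leqNgt.
Qed.

Lemma dist_ge0 v w : 0 <= Omega_dist v w.
Proof. by rewrite /Omega_dist; case: ifP => // _; rewrite invr_ge0 exprn_ge0. Qed.

Lemma dist_triangle v u w : Omega_dist u w <= Omega_dist u v + Omega_dist v w.
Proof.
have [->|uw] := eqVneq u w; first by rewrite distxx addr_ge0 // dist_ge0.
have [->|uv] := eqVneq u v; first by rewrite distxx add0r.
have [->|vw] := eqVneq v w; first by rewrite distxx addr0.
have [c [_ dc] ec] := sep_indexP uw.
have [a [aa _] ea] := sep_indexP uv.
have [b [bb _] eb] := sep_indexP vw.
have le2 m n : (m <= n)%N -> 2 ^- n <= 2 ^- m :> R.
  by move=> mn; rewrite lef_pV2 ?posrE ?exprn_gt0 // ler_eXn2l // ltr1n.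
have [ca|ca] := ltnP c a; last first.
  rewrite (@le_trans _ _ (Omega_dist u v)) ?lerDl ?dist_ge0 //.
  rewrite /Omega_dist (negbTE uw) (negbTE uv) ea ec; apply: le2.
  by rewrite geq_max !leq_max leqnn ca orbT.
have [cb|cb] := ltnP c b; first by move: dc; rewrite aa // bb // eqxx.
rewrite (@le_trans _ _ (Omega_dist v w)) ?lerDr ?dist_ge0 //.
rewrite /Omega_dist (negbTE uw) (negbTE vw) eb ec; apply: le2.
by rewrite geq_max !leq_max leqnn cb orbT.
Qed.

End metric.

HB.instance Definition _ (R : realType) := @isMetric.Build R (Omega R)
  (@Omega_dist R) (@distxx R) (@dist_eq0 R) (@distC R) (@dist_triangle R).

(* Borel sigma-algebra of the metric *)
HB.instance Definition _ (R : realType) :=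
  @isMeasurable.Build (sigma_display (@open (Omega R))) (Omega R)
    <<s @open (Omega R) >> (@sigma_algebra0 _ setT open)
    (@sigma_algebraC _ open) (@sigma_algebra_bigcup _ setT open).

Definition hoelder_continuous (R : realType) (f : Omega R -> R) : Prop :=
  exists C alpha : R, [/\ 0 < alpha, alpha <= 1 &
    forall w w', `|f w - f w'| <= C * mdist w w' `^ alpha].

Definition var_n (R : realType) (n : nat) (f : Omega R -> R) : \bar R :=
  ereal_sup [set r | exists w w', agree n w w' /\ r = (`|f w - f w'|)%:E].

Definition fully_supported (R : realType) (Q : probability (Omega R) R) : Prop :=
  forall U : set (Omega R), open U -> U !=set0 -> (0 < Q U)%E.

Definition translation_invariant (R : realType)
    (Q : probability (Omega R) R) : Prop :=
  forall B : set (Omega R), measurable B -> Q (@left_shift R @^-1` B) = Q B.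

(* the sigma-algebra generated by the coordinates w_1, w_2, ... *)
Definition tail_sigma (R : realType) : set (set (Omega R)) :=
  <<s [set B | exists i a, B = [set w : Omega R | w i.+1 = a]] >>.

(* h is a version of the conditional probability of E given the
   sub-sigma-algebra G *)
Definition is_cond_prob (d : measure_display) (T : measurableType d)
    (R : realType) (Q : probability T R) (G : set (set T)) (E : set T)
    (h : T -> R) : Prop :=
  [/\ forall B : set R, measurable B -> G (h @^-1` B),
      Q.-integrable setT (EFin \o h) &
      forall D, G D -> (\int[Q]_(w in D) (h w)%:E = Q (E `&` D))%E].

Definition g_function (R : realType) (g : Omega R -> R) : Prop :=
  [/\ continuous g,
      forall w, 0 < g w < 1 &
      forall w, \sum_(a : spin) g (scons a (left_shift w)) = 1].

Definition is_g_measure (R : realType) (Q : probability (Omega R) R)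
    (g : Omega R -> R) : Prop :=
  [/\ fully_supported Q, translation_invariant Q, g_function g &
      exists h : spin -> Omega R -> R,
        (forall a, is_cond_prob Q (@tail_sigma R) [set w | w 0%N = a] (h a)) /\
        {ae Q, forall w, h (w 0%N) w = g w}].

Definition bowen_gibbs (R : realType) (Q : probability (Omega R) R)
    (phi : Omega R -> R) : Prop :=
  [/\ fully_supported Q, translation_invariant Q, continuous phi &
      exists Pr C : R, 1 <= C /\ forall (w : Omega R) (n : nat), (1 <= n)%N ->
        C^-1 <= fine (Q [set w' | agree n w' w]) /
                expR (\sum_(k < n) phi (iter k (@left_shift R) w) - n%:R * Pr)
             <= C].

Section processes.
Context (d : measure_display) (T : measurableType d) (R : realType).
Variable P : probability T R.

Definition trajectory (X : nat -> T -> spin) : T -> Omega R := fun t n => X n t.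

(* transition probabilities of the symmetric chain *)
Definition ptrans (p : R) (x x' : spin) : R := if x == x' then 1 - p else p.

(* Markov chain with uniform initial law and transition matrix [ptrans p]; the
   Markov property is stated without division by the probability of the past *)
Definition symmetric_chain (p : R) (X : nat -> {RV P >-> spin}) : Prop :=
  (forall x, P [set t | X 0%N t = x] = (2^-1)%:E) /\
  (forall (n : nat) (x : nat -> spin),
     P [set t | forall i, (i <= n.+1)%N -> X i t = x i] =
     (P [set t | forall i, (i <= n)%N -> X i t = x i] *
      (ptrans p (x n) (x n.+1))%:E)%E).

Definition mutually_independent (Z : nat -> {RV P >-> spin}) : Prop :=
  forall (J : seq nat) (E : nat -> set spin), uniq J ->
    P [set t | forall j, j \in J -> E j (Z j t)] =
    (\prod_(j <- J) P (Z j @^-1` E j))%E.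

Definition iid_noise (eps : R) (Z : nat -> {RV P >-> spin}) : Prop :=
  [/\ mutually_independent Z,
      forall n, P [set t | Z n t = spin_neg] = eps%:E &
      forall n, P [set t | Z n t = spin_pos] = (1 - eps)%:E].

Definition independent_processes (X Z : nat -> {RV P >-> spin}) : Prop :=
  forall A B : set (Omega R), measurable A -> measurable B ->
    P (trajectory X @^-1` A `&` trajectory Z @^-1` B) =
    (P (trajectory X @^-1` A) * P (trajectory Z @^-1` B))%E.

End processes.

Definition is_law (d : measure_display) (T : measurableType d) (R : realType)
    (P : probability T R) (Y : nat -> T -> spin) (Q : probability (Omega R) R)
    : Prop :=
  forall B : set (Omega R), measurable B -> Q B = P (trajectory R Y @^-1` B).

(* Main.v *)
Require Import Defs.
From HB Require Import structures.
From mathcomp Require Import all_boot all_order all_algebra.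
From mathcomp Require Import all_classical all_reals all_analysis.
From mathcomp Require Import ring lra.
Set Implicit Arguments.
Unset Strict Implicit.
Unset Printing Implicit Defensive.
Import Order.TTheory GRing.Theory Num.Theory.
Import numFieldNormedType.Exports.
Local Open Scope classical_set_scope.
Local Open Scope ring_scope.

(* Conditionally on w_1 .. w_n, the output w_0 has a probability that depends
   only on r_n, the conditional probability that X_1 = 1, through an affine map
   with values in [m, 1 - m], m > 0. The number r_n is obtained from 1/2 by n
   random maps (a Markov step followed by Bayes' rule), each contracting the
   log-odds distance in the sense of update_contraction; hence r_n converges
   uniformly at rate |1 - 2 p|^n to a function r, and g is the affine map of r.
   The probability of a cylinder is exactly the product of these conditional
   probabilities, so its logarithm differs from the Birkhoff sum of ln g by a
   geometric series, which is the Bowen-Gibbs property with pressure 0. That g is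
   the conditional probability on the tail holds on cylinders of length k up to a
   relative error rho^k, and therefore exactly. *)

Lemma spinP (a : spin) : a = spin_neg \/ a = spin_pos.
Proof.
have := valP a; rewrite !inE => /orP[] /eqP h; [left|right]; exact/val_inj.
Qed.

(** * Cylinders, topology and measurability on the sequence space *)

Section Omega.
Context (R : realType).
Implicit Types (n : nat) (w v : Omega R) (f : Omega R -> R).

Definition cylinder n w : set (Omega R) := [set w' | agree n w' w].

(** The inequality has to be strict: sequences that differ at coordinate 0 are at distance 1/2, so
    [<=] would fail at n = 1. *)
Lemma mdist_agree n w w' : mdist w w' < 2 ^- n -> agree n w w'.
Proof.
rewrite [mdist w w']/(Omega_dist w w') /Omega_dist.
have [->//|ww'] := eqVneq w w'; have [k [ak _] ->] := sep_indexP ww'.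
rewrite ltf_pV2 ?posrE ?exprn_gt0 // ltr_eXn2l ?ltr1n // => nk.
case: n nk => // n nk i ni; apply: ak; apply: (leq_trans ni).
by case: k nk => [|k]; rewrite ?maxn0 // ?(maxn_idPr _) // => /ltnW.
Qed.

Lemma nbhs_cylinder n w : nbhs w (cylinder n w).
Proof.
apply/nbhs_ballP; exists (2 ^- n) => /=; first by rewrite invr_gt0 exprn_gt0.
by move=> w'; rewrite ballEmdist /= => /mdist_agree/agree_sym.
Qed.

Lemma agree_trans n w v u : agree n w v -> agree n v u -> agree n w u.
Proof. by move=> a b i ni; rewrite a // b. Qed.

Lemma agree_le n m w v : (n <= m)%N -> agree m w v -> agree n w v.
Proof. by move=> nm a i ni; apply: a; exact: leq_trans nm. Qed.

Lemma open_cylinder n w : open (cylinder n w).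
Proof.
rewrite openE => v vw; apply: filterS (nbhs_cylinder n v) => u uv.
exact: agree_trans vw.
Qed.

Lemma cylinder_sub_nbhs w (U : set (Omega R)) : nbhs w U ->
  exists n, cylinder n w `<=` U.
Proof.
move/nbhs_ballP => [e /= e0 eU].
have : `|2^-1 : R| < 1 by rewrite ger0_norm ?invr_ge0 // invf_lt1 // ltr1n.
move=> /cvg_expr/cvgrPdist_lt/(_ e e0)[n _ /(_ n.+1 (leqnSn n))] /=.
rewrite sub0r normrN ger0_norm ?exprn_ge0 ?invr_ge0 // exprVn => ne.
exists n.+1 => v vw; apply: eU; rewrite ballEmdist /=; apply: le_lt_trans ne.
rewrite [mdist w v]/(Omega_dist w v) /Omega_dist.
case: ifPn => [_|wv]; first by rewrite invr_ge0 exprn_ge0.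
have [k [_ dk] ->] := sep_indexP wv.
rewrite lef_pV2 ?posrE ?exprn_gt0 // ler_eXn2l ?ltr1n // leq_max; apply/orP; right.
by rewrite ltnNge; apply/negP => kn; move: dk; rewrite vw ?eqxx // ltnS.
Qed.

(** Indexing by finite words makes the family countable, so unions over it preserve measurability.
    The default value of [nth] is never read. *)
Definition word_cylinder (s : seq spin) : set (Omega R) :=
  cylinder (size s) (nth spin_pos s).

Lemma open_word_cylinders (U : set (Omega R)) : open U ->
  U = \bigcup_(s in [set s | word_cylinder s `<=` U]) word_cylinder s.
Proof.
rewrite openE => oU; apply/seteqP; split=> [w /oU/cylinder_sub_nbhs[n nU]|w [s]].
  have ws : agree n w (nth spin_pos (mkseq w n)) by move=> i ni; rewrite nth_mkseq.
  exists (mkseq w n) => /=; rewrite /word_cylinder size_mkseq //.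
  by move=> v av; apply: nU; apply: agree_trans av _; exact: agree_sym.
exact.
Qed.

(** An open set is a countable union of word cylinders, and each of these is a finite intersection
    of coordinate events. *)
Lemma measurable_to_Omega (d : measure_display) (T : measurableType d)
    (f : T -> Omega R) :
  (forall i a, measurable [set t | f t i = a]) -> measurable_fun setT f.
Proof.
move=> mf; apply: (measurability (@open (Omega R))) => //.
move=> _ [U oU <-]; rewrite setTI (open_word_cylinders oU) preimage_bigcup.
rewrite bigcup_mkcond; apply: countable_bigcupT_measurable => // s.
case: ifP => // _.
have -> : f @^-1` word_cylinder s =
    \bigcap_(i in [set i | (i < size s)%N]) [set t | f t i = nth spin_pos s i].
  by apply/seteqP; split=> t /= h i; exact: h.
by apply: bigcap_measurableType.
Qed.

Lemma measurable_cylinder n w : measurable (cylinder n w).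
Proof. by apply: sub_sigma_algebra; exact: open_cylinder. Qed.

Lemma measurable_coordinate i a : measurable [set w : Omega R | w i = a].
Proof.
apply: sub_sigma_algebra; rewrite openE => w <-.
by apply: filterS (nbhs_cylinder i.+1 w) => v /(_ i); exact.
Qed.

Lemma measurable_left_shift : measurable_fun setT (@left_shift R).
Proof. by apply: measurable_to_Omega => i a; exact: measurable_coordinate. Qed.

Lemma continuous_measurable_Omega f : continuous f -> measurable_fun setT f.
Proof.
move=> cf; apply: (measurability _ (measurable_realfun.RGenOInfty.measurableE R)).
move=> _ [_ [x ->] <-]; rewrite setTI; apply: sub_sigma_algebra.
apply: open_comp; first by move=> w _; exact: cf.
exact: interval_open.
Qed.

(** With [preimage_tail_sigma], this identifies the tail sigma-algebra with the pullback of the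
    Borel sets under the shift, so conditioning on the tail only involves events of that form. *)
Lemma tail_sigma_preimage (D : set (Omega R)) : @tail_sigma R D ->
  exists2 B, measurable B & D = @left_shift R @^-1` B.
Proof.
have sub : @tail_sigma R `<=` preimage_set_system setT (@left_shift R) measurable.
  apply: smallest_sub; first exact: sigma_algebra_preimage (sigma_algebra_measurable _).
  move=> _ [i [a ->]]; exists [set w : Omega R | w i = a].
    exact: measurable_coordinate.
  by rewrite setTI.
by move=> /sub[B mB <-]; exists B => //; rewrite setTI.
Qed.

Lemma preimage_tail_sigma (B : set (Omega R)) : measurable B ->
  @tail_sigma R (@left_shift R @^-1` B).
Proof.
move=> mB; set G := [set B | exists i a, B = [set w : Omega R | w i.+1 = a]].
have mS : measurable_fun [set: g_sigma_algebraType G] (@left_shift R).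
  by apply: measurable_to_Omega => i a; apply: sub_sigma_algebra; exists i, a.
by have := mS measurableT B mB; rewrite setTI.
Qed.

(** * Measures determined by their values on cylinders *)

Definition cylinders : set (set (Omega R)) :=
  [set B | B = set0 \/ exists n w, B = cylinder n w].

(** Two cylinders that share a point u intersect in the cylinder of u of the larger length;
    otherwise their intersection is the empty set, which [cylinders] contains for this purpose. *)
Lemma cylinders_setI_closed : setI_closed cylinders.
Proof.
move=> A B [->|[n [w ->]]]; first by rewrite set0I; left.
move=> [->|[k [v ->]]]; first by rewrite setI0; left.
have [/eqP->|/set0P[u [un uk]]] := boolP (cylinder n w `&` cylinder k v == set0).
  by left.
right; exists (maxn n k), u; apply/seteqP; split=> z.
  move=> [zn zk] i; rewrite leq_max => /orP[ni|ki]; first by rewrite zn // un.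
  by rewrite zk // uk.
move=> h; split.
  by apply: agree_trans un; apply: agree_le h; rewrite leq_maxl.
by apply: agree_trans uk; apply: agree_le h; rewrite leq_maxr.
Qed.

Lemma cylinders_generate : measurable = <<s cylinders >> :> set (set (Omega R)).
Proof.
apply/seteqP; split=> B mB.
  (* The inclusion with content: measurability of the identity from the sigma-algebra generated by
     cylinders to the Borel one. *)
  have mid : measurable_fun [set: g_sigma_algebraType cylinders] (id : _ -> Omega R).
    apply: measurable_to_Omega => i a.
    have -> : [set w : g_sigma_algebraType cylinders | w i = a] =
      \bigcup_(s in [set s | word_cylinder s `<=` [set w : Omega R | w i = a]])
        word_cylinder s.
      apply: open_word_cylinders; rewrite openE => w <-.
      by apply: filterS (nbhs_cylinder i.+1 w) => v /(_ i); exact.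
    rewrite bigcup_mkcond; apply: countable_bigcupT_measurable => // s.
    by case: ifP => // _; apply: sub_sigma_algebra; right; do 2 eexists.
  by have := mid measurableT B mB; rewrite setTI preimage_id.
move: B mB; apply: smallest_sub; first exact: sigma_algebra_measurable.
by move=> _ [->|[n [w ->]]] //; exact: measurable_cylinder.
Qed.

Lemma measure_eq_on_cylinders (m1 m2 : {measure set (Omega R) -> \bar R}) :
  (m1 setT < +oo)%E -> (forall n w, m1 (cylinder n w) = m2 (cylinder n w)) ->
  forall B, measurable B -> m1 B = m2 B.
Proof.
move=> fin eq12.
have T0 : [set: Omega R] = cylinder 0 point by apply/seteqP.
apply: (@measure_unique _ _ _ cylinders (fun=> setT)) => //.
- exact: cylinders_generate.
- exact: cylinders_setI_closed.
- by move=> _; right; exists 0%N, point.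
- by apply/seteqP; split=> // w _; exists 0%N.
- by move=> A [->|[n [w ->]]]; rewrite ?measure0.
Qed.

Definition set_at n w (b : spin) : Omega R := fun i => if i == n then b else w i.

Lemma measure_cylinder_split (mu : {measure set (Omega R) -> \bar R}) n w :
  mu (cylinder n w) = (mu (cylinder n.+1 (set_at n w spin_pos)) +
                       mu (cylinder n.+1 (set_at n w spin_neg)))%E.
Proof.
have atn b : set_at n w b n = b by rewrite /set_at eqxx.
have atlt b i : (i < n)%N -> set_at n w b i = w i.
  by move=> ni; rewrite /set_at ltn_eqF.
rewrite -measureU; try exact: measurable_cylinder; last first.
  by apply/seteqP; split=> v // [/(_ n (leqnn _))/= e /(_ n (leqnn _))/=]; rewrite e !atn.
congr (mu _); apply/seteqP; split=> v.
  move=> vw; have [e|e] : v n = spin_pos \/ v n = spin_neg.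
    by case: (spinP (v n)); [right|left].
  - by left=> i; rewrite ltnS leq_eqVlt => /predU1P[->|ni]; [rewrite atn|rewrite atlt ?vw].
  - by right=> i; rewrite ltnS leq_eqVlt => /predU1P[->|ni]; [rewrite atn|rewrite atlt ?vw].
by case=> h i ni; rewrite h ?atlt // ltnW.
Qed.

(* The hypothesis at level n + j, summed over the cylinders of that level that
   make up a cylinder of level n, improves the error from rho^n to rho^(n + j). *)
Lemma measure_eq_of_close_on_cylinders
    (m1 m2 q : {measure set (Omega R) -> \bar R}) (C rho : R) :
  (m1 setT < +oo)%E -> (m2 setT < +oo)%E -> (q setT < +oo)%E -> 0 <= rho < 1 ->
  (forall n w, `|fine (m1 (cylinder n w)) - fine (m2 (cylinder n w))| <=
    C * rho ^+ n * fine (q (cylinder n w))) ->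
  forall B, measurable B -> m1 B = m2 B.
Proof.
move=> fin1 fin2 finq /andP[rho0 rho1] close.
have finm (mu : {measure set (Omega R) -> \bar R}) n w :
    (mu setT < +oo)%E -> mu (cylinder n w) \is a fin_num.
  move=> finT; rewrite ge0_fin_numE ?measure_ge0 //; apply: le_lt_trans finT.
  by apply: le_measure; rewrite ?inE //; exact: measurable_cylinder.
have refined j n w : `|fine (m1 (cylinder n w)) - fine (m2 (cylinder n w))| <=
    C * rho ^+ (n + j) * fine (q (cylinder n w)).
  elim: j n w => [|j IH] n w; first by rewrite addn0.
  rewrite (measure_cylinder_split m1) (measure_cylinder_split m2).
  rewrite (measure_cylinder_split q) !fineD; try exact: finm.
  by rewrite opprD addrACA mulrDr addnS -addSn; apply: le_trans (ler_normD _ _) (lerD _ _).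
apply: measure_eq_on_cylinders => // n w.
rewrite -(fineK (finm m1 n w fin1)) -(fineK (finm m2 n w fin2)); congr EFin.
apply/eqP; rewrite -subr_eq0 -normr_le0; apply/ler_addgt0Pr => e e0; rewrite add0r.
(* In [refined], j is free while the cylinder is fixed: letting j grow makes the bound smaller than
   any e. *)
have : `|rho| < 1 by rewrite ger0_norm.
move=> /(cvg_geometric (C * rho ^+ n * fine (q (cylinder n w)))).
move=> /cvgrPdist_lt/(_ e e0)[j _ /(_ j (leqnn j))] /=; rewrite sub0r normrN => h.
apply: le_trans (refined j n w) _; apply/ltW; apply: le_lt_trans h.
by rewrite exprD mulrA mulrAC ler_norm.
Qed.

(** * Functions with exponentially decaying variation *)

Definition exp_variation f (C rho : R) :=
  forall n w w', agree n w w' -> `|f w - f w'| <= C * rho ^+ n.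

Lemma exp_variation_continuous f (C rho : R) :
  0 <= rho < 1 -> exp_variation f C rho -> continuous f.
Proof.
move=> /andP[r0 r1] hf w; apply/(@cvgrPdist_lt _ _ _ (nbhs w) (nbhs_filter w)) => e e0.
have : `|rho| < 1 by rewrite ger0_norm.
move=> /(cvg_geometric C)/cvgrPdist_lt/(_ e e0)[n _ /(_ n (leqnn n))] /=.
rewrite sub0r normrN => ne.
apply: filterS (nbhs_cylinder n w) => v /agree_sym/hf h.
by apply: le_lt_trans h (le_lt_trans (ler_norm _) ne).
Qed.

(** With alpha = - ln rho / ln 2 one has rho^k = (2^-k)^alpha, and rho >= 1/2 means alpha <= 1. *)
Lemma exp_variation_hoelder f (C rho : R) :
  2^-1 <= rho < 1 -> exp_variation f C rho -> hoelder_continuous f.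
Proof.
move=> /andP[r2 r1] hf; have r0 : 0 < rho by lra.
have ln20 : 0 < ln (2 : R) by rewrite ln_gt0 // ltr1n.
have C0 : 0 <= C.
  by have := hf 0%N point point (fun _ _ => erefl); rewrite subrr normr0 mulr1.
(* The factor 1 / rho covers sequences that differ at coordinate 0: they agree on k = 0 coordinates,
   but their distance is 2^-1. *)
exists (C / rho), (- ln rho / ln 2); split.
- by rewrite divr_gt0 // oppr_gt0 ln_lt0 // r0.
- by rewrite ler_pdivrMr // mul1r lerNl -lnV ?posrE // ler_ln ?posrE // invr_gt0.
move=> w w'; have [->|ww'] := eqVneq w w'.
  by rewrite subrr normr0 mulr_ge0 ?powR_ge0 // divr_ge0 // ltW.
have [k [ak _] ek] := sep_indexP ww'.
rewrite [mdist w w']/(Omega_dist w w') /Omega_dist (negbTE ww') ek.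
have -> : (2 ^- maxn 1 k) `^ (- ln rho / ln 2) = rho ^+ maxn 1 k :> R.
  rewrite /powR gt_eqF ?invr_gt0 ?exprn_gt0 // lnV ?posrE ?exprn_gt0 // lnXn //.
  rewrite mulrN !mulNr opprK -[ln 2 *+ _]mulr_natl mulrCA divfK ?gt_eqF //.
  by rewrite expRM_natl lnK ?posrE.
apply: le_trans (hf _ _ _ ak) _; rewrite -mulrA ler_wpM2l //.
rewrite ler_pdivlMl // -exprS ler_wiXn2l // ?ltW //.
by rewrite geq_max leqnSn.
Qed.

End Omega.

(** * The backward filter and its uniform bounds *)

Section filter.
Context (R : realType) (p eps : R).
Context (hp : 0 < p < 1) (heps : 0 < eps < 1).

Definition emission (x a : spin) : R := if x == a then 1 - eps else eps.

(* The filter runs backwards in time: if r is the probability that the hidden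
   state at time i + 1 is 1 given the outputs from time i + 1 on, then predict r
   is the one for the state at time i given the same outputs (by reversibility of
   the chain), next_prob a r the probability that the output at time i is a, and
   update a r includes this output in the conditioning. *)
Definition predict (r : R) : R := p + (1 - 2 * p) * r.

Definition next_prob (a : spin) (r : R) : R :=
  emission spin_pos a * predict r + emission spin_neg a * (1 - predict r).

Definition update (a : spin) (r : R) : R :=
  emission spin_pos a * predict r / next_prob a r.

Lemma sum_spin (V : nmodType) (F : spin -> V) :
  \sum_(a : spin) F a = F spin_pos + F spin_neg.
Proof.
rewrite (bigD1 spin_pos) //= (bigD1 spin_neg) //= big1 ?addr0 // => a.
by case: (spinP a) => ->.
Qed.

Lemma emissionE (a : spin) :
  (emission spin_pos a = 1 - eps /\ emission spin_neg a = eps) \/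
  (emission spin_pos a = eps /\ emission spin_neg a = 1 - eps).
Proof. by case: (spinP a) => ->; rewrite /emission /=; [right|left]. Qed.

Lemma sum_next_prob r : \sum_(a : spin) next_prob a r = 1.
Proof. by rewrite sum_spin /next_prob /emission /=; ring. Qed.

(** A common lower bound for all transition and emission probabilities. It passes to [predict] and
    [next_prob], which are convex combinations of p, 1 - p and of eps, 1 - eps. *)
Definition floor_prob : R := Num.min (Num.min p (1 - p)) (Num.min eps (1 - eps)).
Local Notation m := (floor_prob).

Lemma floor_probP : [/\ 0 < m, m <= p, m <= 1 - p, m <= eps & m <= 1 - eps].
Proof.
move: hp heps => /andP[? ?] /andP[? ?].
have H1 : m <= Num.min p (1 - p) by rewrite /m ge_min lexx.
have H2 : m <= Num.min eps (1 - eps) by rewrite /m ge_min lexx orbT.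
have H1a : Num.min p (1 - p) <= p by rewrite ge_min lexx.
have H1b : Num.min p (1 - p) <= 1 - p by rewrite ge_min lexx orbT.
have H2a : Num.min eps (1 - eps) <= eps by rewrite ge_min lexx.
have H2b : Num.min eps (1 - eps) <= 1 - eps by rewrite ge_min lexx orbT.
by split; rewrite ?lt_min ?subr_gt0; lra.
Qed.

Lemma predict_bounds (r : R) : 0 <= r <= 1 -> m <= predict r <= 1 - m.
Proof.
case: floor_probP => ? ? ? ? ? /andP[? ?]; rewrite /predict; apply/andP; split; nra.
Qed.

Lemma next_prob_bounds a (r : R) : 0 <= r <= 1 -> m <= next_prob a r <= 1 - m.
Proof.
move/predict_bounds => /andP[]; case: floor_probP => ? ? ? ? ?.
rewrite /next_prob; move: (predict r) => s ? ?.
by case: (emissionE a) => -[-> ->]; apply/andP; split; nra.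
Qed.

Lemma next_prob_gt0 a (r : R) : 0 <= r <= 1 -> 0 < next_prob a r.
Proof.
move/(next_prob_bounds a) => /andP[h _]; case: floor_probP => ? _ _ _ _.
exact: lt_le_trans h.
Qed.

Lemma next_prob_diff a (r r' : R) : `|next_prob a r - next_prob a r'| <= `|r - r'|.
Proof.
have -> : next_prob a r - next_prob a r' =
    (emission spin_pos a - emission spin_neg a) * (1 - 2 * p) * (r - r').
  by rewrite /next_prob /predict; ring.
rewrite normrM -[leRHS]mul1r ler_wpM2r // normrM mulr_ile1 // ler_norml.
  by move: heps => /andP[? ?]; case: (emissionE a) => -[-> ->]; lra.
by move: hp => /andP[? ?]; lra.
Qed.

(** * Contraction of the filter *)

Definition posterior_range : set R := [set r | m ^+ 2 <= r <= 1 - m ^+ 2].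

Lemma posterior_range01 r : posterior_range r -> 0 <= r <= 1.
Proof.
by case: floor_probP => ? ? ? ? ? /andP[? ?]; apply/andP; split; nra.
Qed.

Lemma posterior_range_half : posterior_range 2^-1.
Proof.
case: floor_probP => ? ? ? ? ?; rewrite /posterior_range /=.
have ? : m <= 2^-1 by lra.
by apply/andP; split; nra.
Qed.

(** The two terms of [next_prob] are each at least m^2 and their sum is at most 1, so either one
    divided by the sum is at least m^2. *)
Lemma posterior_range_update a (r : R) : 0 <= r <= 1 -> posterior_range (update a r).
Proof.
move=> r01; have /andP[h1 h2] := predict_bounds r01.
have n0 := next_prob_gt0 a r01; have /andP[n1 n2] := next_prob_bounds a r01.
case: floor_probP => ? ? ? ? ?.
rewrite /posterior_range /update /=; rewrite ler_pdivlMr // ler_pdivrMr //.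
move: n0 n1 n2; rewrite /next_prob; move: (predict r) h1 h2 => s h1 h2.
by case: (emissionE a) => -[-> ->] n0 n1 n2; apply/andP; split; nra.
Qed.

(* The contracted quantity is (r - r')^2 / (r (1 - r) r' (1 - r')), the square of
   2 sinh of half the difference of the log-odds of r and r'; conditioning on an
   emission leaves it unchanged, and one Markov step shrinks it by (1 - 2 p)^2. *)
Lemma update_contraction a (r r' c : R) : 0 <= r <= 1 -> 0 <= r' <= 1 -> 0 <= c ->
  (r - r') ^+ 2 <= c * (r * (1 - r) * (r' * (1 - r'))) ->
  (update a r - update a r') ^+ 2 <= (c * (1 - 2 * p) ^+ 2) *
    (update a r * (1 - update a r) * (update a r' * (1 - update a r'))).
Proof.
move=> r01 r'01 c0 h.
have n0 := next_prob_gt0 a r01; have n0' := next_prob_gt0 a r'01.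
have /andP[s1 s2] := predict_bounds r01; have /andP[s1' s2'] := predict_bounds r'01.
set n := next_prob a r in n0 *; set n' := next_prob a r' in n0' *.
set s := predict r in s1 s2; set s' := predict r' in s1' s2'.
set A := emission spin_pos a; set B := emission spin_neg a.
have nE : n = A * s + B * (1 - s) by [].
have nE' : n' = A * s' + B * (1 - s') by [].
have uE : update a r = A * s / n by [].
have uE' : update a r' = A * s' / n' by [].
have nn : n != 0 by rewrite gt_eqF.
have nn' : n' != 0 by rewrite gt_eqF.
have wE : 1 - update a r = B * (1 - s) / n.
  by rewrite uE; apply: (mulIf nn); rewrite mulrBl !divfK // mul1r nE; ring.
have wE' : 1 - update a r' = B * (1 - s') / n'.
  by rewrite uE'; apply: (mulIf nn'); rewrite mulrBl !divfK // mul1r nE'; ring.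
have dE : update a r - update a r' = A * B * (s - s') / (n * n').
  rewrite uE uE'; apply: (mulIf (mulf_neq0 nn nn')); rewrite divfK ?mulf_neq0 //.
  have -> : (A * s / n - A * s' / n') * (n * n') =
    A * s * n' * (n / n) - A * s' * n * (n' / n') by ring.
  by rewrite !divff // nE nE'; ring.
rewrite wE wE' dE uE uE'.
(* Bayes' rule puts the same factor (A B / (n n'))^2 on both sides; only the Markov step is left to
   compare. *)
have -> : (A * B * (s - s') / (n * n')) ^+ 2 =
  (A * B / (n * n')) ^+ 2 * (s - s') ^+ 2 by ring.
have -> : c * (1 - 2 * p) ^+ 2 *
   (A * s / n * (B * (1 - s) / n) * (A * s' / n' * (B * (1 - s') / n'))) =
  (A * B / (n * n')) ^+ 2 *
    ((1 - 2 * p) ^+ 2 * (c * (s * (1 - s) * (s' * (1 - s'))))).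
  by rewrite !invfM; ring.
apply: ler_wpM2l; first exact: sqr_ge0.
have -> : (s - s') ^+ 2 = (1 - 2 * p) ^+ 2 * (r - r') ^+ 2.
  by rewrite /s /s' /predict; ring.
apply: ler_wpM2l; first exact: sqr_ge0.
apply: (le_trans h); apply: ler_wpM2l => //.
(* A Markov step moves the law towards the uniform one, which can only increase the variance x (1 -
   x). *)
have grow (x : R) : 0 <= x <= 1 ->
    0 <= x * (1 - x) <= predict x * (1 - predict x).
  move: hp => /andP[p0 p1] /andP[x0 x1].
  have -> : predict x * (1 - predict x) = x * (1 - x) + p * (1 - p) * (1 - 2 * x) ^+ 2.
    by rewrite /predict; ring.
  rewrite mulr_ge0 ?subr_ge0 //= lerDl mulr_ge0 ?sqr_ge0 // mulr_ge0 ?subr_ge0 //;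
  exact: ltW.
have /andP[? ?] := grow _ r01; have /andP[? ?] := grow _ r'01.
exact: ler_pM.
Qed.

(** The output w_0 is processed last. The seed r describes the hidden state at time n given the
    outputs from time n on; the stationary value 1/2 stands for no such outputs. *)
Fixpoint posterior (n : nat) (w : Omega R) (r : R) : R :=
  if n is n'.+1 then update (w 0%N) (posterior n' (left_shift w) r) else r.

Lemma posterior_range_posterior n w r :
  posterior_range r -> posterior_range (posterior n w r).
Proof.
by elim: n w => //= n IH w /IH h; exact/posterior_range_update/posterior_range01.
Qed.

Lemma eq_posterior n w w' r : agree n w w' -> posterior n w r = posterior n w' r.
Proof.
elim: n w w' => //= n IH w w' h; rewrite h //; congr update.
by apply: IH => i ni; exact: h.
Qed.

(** Turns a comparison of two horizons into a comparison of two seeds at the same horizon n. *)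
Lemma posteriorD n k w r :
  posterior (n + k) w r = posterior n w (posterior k (iter n (@left_shift R) w) r).
Proof. by elim: n w => //= n IH w; rewrite IH -iterSr. Qed.

(** Iterates [update_contraction]. The constant m^-8 serves n = 0, where (r - r')^2 <= 1 and each x
    (1 - x) is at least m^4. *)
Lemma posterior_contraction n w r r' : posterior_range r -> posterior_range r' ->
  (posterior n w r - posterior n w r') ^+ 2 <=
  (m ^- 8 * (1 - 2 * p) ^+ 2 ^+ n) *
    (posterior n w r * (1 - posterior n w r) *
     (posterior n w r' * (1 - posterior n w r'))).
Proof.
move=> hr hr'; have [m0 *] := floor_probP.
elim: n w => [|n IH] w /=.
  have low (x : R) : posterior_range x -> m ^+ 4 <= x * (1 - x).
    move=> /andP[x1 x2]; have -> : m ^+ 4 = m ^+ 2 * m ^+ 2 by rewrite -exprD.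
    have ? : m ^+ 2 <= 1 - x by rewrite lerBrDr addrC -lerBrDr.
    by apply: ler_pM => //; rewrite exprn_ge0 // ltW.
  rewrite expr0 mulr1; apply: (@le_trans _ _ 1).
    have /andP[? ?] := posterior_range01 hr.
    have /andP[? ?] := posterior_range01 hr'.
    by rewrite -real_normK ?num_real // expr_le1 // ler_norml; lra.
  rewrite ler_pdivlMl ?exprn_gt0 // mulr1.
  have -> : m ^+ 8 = m ^+ 4 * m ^+ 4 by rewrite -exprD.
  by apply: ler_pM; rewrite ?low // exprn_ge0 // ltW.
rewrite (exprSr ((1 - 2 * p) ^+ 2)) [X in _ <= X * _]mulrA.
apply: update_contraction; last exact: IH.
- exact/posterior_range01/posterior_range_posterior.
- exact/posterior_range01/posterior_range_posterior.
- apply: mulr_ge0; first by rewrite invr_ge0 exprn_ge0 // ltW.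
  by rewrite exprn_ge0 // sqr_ge0.
Qed.

(* At least 1/2, so that rho^n = (2^-n)^alpha with alpha <= 1. *)
Definition rate : R := (1 + `|1 - 2 * p|) / 2.

Lemma rateP : 2^-1 <= rate < 1.
Proof.
have : `|1 - 2 * p| < 1 by move: hp => /andP[? ?]; rewrite ltr_norml; lra.
by have := normr_ge0 (1 - 2 * p); rewrite /rate; lra.
Qed.

Lemma rate_gt0 : 0 < rate.
Proof. by have /andP[? _] := rateP; lra. Qed.

(** The square root of the constant m^-8 in [posterior_contraction]. *)
Definition gap : R := m ^- 4.

Lemma gap_gt0 : 0 < gap.
Proof. by have [? *] := floor_probP; rewrite invr_gt0 exprn_gt0. Qed.

(** The square root of [posterior_contraction], with x (1 - x) <= 1 and |1 - 2 p| <= [rate]. *)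
Lemma posterior_diff n w w' r r' : agree n w w' ->
  posterior_range r -> posterior_range r' ->
  `|posterior n w r - posterior n w' r'| <= gap * rate ^+ n.
Proof.
move=> /eq_posterior <- hr hr'.
have g0 : 0 <= gap * rate ^+ n.
  by rewrite mulr_ge0 ?exprn_ge0 // ltW ?gap_gt0 ?rate_gt0.
rewrite -(@ler_pXn2r _ 2) ?nnegrE // real_normK ?num_real //.
apply: (le_trans (posterior_contraction n w hr hr')).
have quarter (x : R) : 0 <= x <= 1 -> 0 <= x * (1 - x) <= 1.
  by move=> /andP[? ?]; apply/andP; split; nra.
have /andP[a0 a1] := quarter _ (posterior_range01 (posterior_range_posterior n w hr)).
have /andP[b0 b1] := quarter _ (posterior_range01 (posterior_range_posterior n w hr')).
have [m0 *] := floor_probP.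
rewrite -[leRHS]mulr1; apply: ler_pM => //.
- apply: mulr_ge0; first by rewrite invr_ge0 exprn_ge0 // ltW.
  by rewrite exprn_ge0 // sqr_ge0.
- by rewrite mulr_ge0.
- have e8 : gap ^+ 2 = m ^- 8 by rewrite expr2 /gap -invfM -exprD.
  rewrite [leRHS]exprMn e8; apply: ler_wpM2l.
    by rewrite invr_ge0 exprn_ge0 // ltW.
  rewrite -[(rate ^+ n) ^+ 2]exprM mulnC [leRHS]exprM; apply: lerXn2r; rewrite ?nnegrE ?sqr_ge0 //.
  rewrite -(@real_normK _ (1 - 2 * p)) ?num_real //; apply: lerXn2r; rewrite ?nnegrE ?normr_ge0 //.
    by rewrite ltW // rate_gt0.
  have : `|1 - 2 * p| < 1 by move: hp => /andP[? ?]; rewrite ltr_norml; lra.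
  by rewrite /rate; lra.
- exact: mulr_ile1.
Qed.

(** * The limit of the filter and the function g *)

Definition lim_posterior (w : Omega R) : R :=
  lim (posterior n w 2^-1 @[n --> \oo]).

Lemma rate_lt (e : R) : 0 < e -> exists N, gap * rate ^+ N < e.
Proof.
move=> e0; have /andP[_ r1] := rateP.
have : `|rate| < 1 by rewrite ger0_norm // ltW // rate_gt0.
move=> /(cvg_geometric gap) /cvgrPdist_lt /(_ e e0) [N _ /(_ N (leqnn N))] /= h.
by exists N; move: h; rewrite sub0r normrN; apply: le_lt_trans; rewrite ler_norm.
Qed.

Lemma posterior_cvg w : posterior n w 2^-1 @[n --> \oo] --> lim_posterior w.
Proof.
apply/cauchy_cvgP/cauchy_exP => e e0; have [N hN] := rate_lt e0.
exists (posterior N w 2^-1); exists N => // k /= Nk; apply: le_lt_trans hN.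
(* Both values are filters of horizon N that differ only in their seed. *)
rewrite -(subnKC Nk) posteriorD; apply: posterior_diff => //.
  exact: posterior_range_half.
exact/posterior_range_posterior/posterior_range_half.
Qed.

(** The seed r is arbitrary: the limit is approached by horizon n + N, which is horizon n with
    another seed in [posterior_range]. *)
Lemma lim_posterior_diff n w w' r : agree n w w' -> posterior_range r ->
  `|lim_posterior w - posterior n w' r| <= gap * rate ^+ n.
Proof.
move=> a hr; apply/ler_addgt0Pr => e e0.
have /cvgrPdist_lt /(_ e e0) [N _ hN] := @posterior_cvg w.
have := hN (n + N)%N (leq_addl _ _); rewrite /= posteriorD => h.
have := posterior_diff a
  (posterior_range_posterior N (iter n (@left_shift R) w) posterior_range_half) hr.
move=> h'; rewrite [leRHS]addrC; apply: le_trans (lerD (ltW h) h').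
exact: ler_distD.
Qed.

Lemma posterior_range_lim w : posterior_range (lim_posterior w).
Proof.
have c : cvgn (fun n => posterior n w 2^-1) by apply/cvg_ex; eexists; exact: posterior_cvg.
have h n := posterior_range_posterior n w posterior_range_half.
apply/andP; split.
  by apply: limr_ge => //; near=> n; have /andP[] := h n.
by apply: limr_le => //; near=> n; have /andP[] := h n.
Unshelve. all: by end_near.
Qed.

Definition gfun (w : Omega R) : R :=
  next_prob (w 0%N) (lim_posterior (left_shift w)).

Lemma gfun_bounds w : m <= gfun w <= 1 - m.
Proof. exact/next_prob_bounds/posterior_range01/posterior_range_lim. Qed.

(** Both limits are compared with [posterior n w' 2^-1], hence the factor 2. *)
Lemma lim_posterior_variation n w w' : agree n w w' ->
  `|lim_posterior w - lim_posterior w'| <= 2 * gap * rate ^+ n.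
Proof.
move=> a; have := lim_posterior_diff a posterior_range_half.
have /lim_posterior_diff/(_ posterior_range_half) : agree n w' w' by [].
rewrite -mulrA mulr2n mulrDl !mul1r (distrC (lim_posterior w')) => h1 h2.
by apply: le_trans (lerD h2 h1); exact: ler_distD.
Qed.

(** Dividing by [rate] makes up for the coordinate lost to the shift: agreement on n + 1 coordinates
    leaves n for the tails. *)
Lemma gfun_variation n w w' : agree n w w' ->
  `|gfun w - gfun w'| <= 2 * gap / rate * rate ^+ n.
Proof.
have r0 := rate_gt0; have g0 := gap_gt0.
case: n => [_|n a].
  have /andP[? ?] := rateP.
  have /andP[g1 g2] := gfun_bounds w; have /andP[g3 g4] := gfun_bounds w'.
  have [m0 m1 m2 *] := floor_probP.
  (* At n = 0 the trivial oscillation bound 1 suffices, as [gap] >= 1 > [rate]. *)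
  have gap1 : 1 <= gap.
    by rewrite /gap -exprVn exprn_ege1 // invf_ge1 //; lra.
  rewrite mulr1 (@le_trans _ _ 1) //; first by rewrite ler_norml; lra.
  by rewrite ler_pdivlMr // mul1r; lra.
rewrite /gfun a // exprS mulrA divfK ?gt_eqF //.
apply: le_trans (next_prob_diff _ _ _) _.
by apply: lim_posterior_variation => i ni; exact: a.
Qed.

(** * Cylinder probabilities and their comparison with products of g *)

Fixpoint cyl_prob (n : nat) (w : Omega R) : R :=
  if n is n'.+1 then
    next_prob (w 0%N) (posterior n' (left_shift w) 2^-1) * cyl_prob n' (left_shift w)
  else 1.

Lemma cyl_prob_gt0 n w : 0 < cyl_prob n w.
Proof.
elim: n w => //= n IH w; rewrite mulr_gt0 // next_prob_gt0 //.
exact/posterior_range01/posterior_range_posterior/posterior_range_half.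
Qed.

(* likelihood n w x is the probability that the first n outputs are those of w
   when the hidden chain starts at x. *)
Fixpoint likelihood (n : nat) (w : Omega R) (x : spin) : R :=
  if n is n'.+1 then
    emission x (w 0%N) *
      \sum_(x' : spin) ptrans p x x' * likelihood n' (left_shift w) x'
  else 1.

Lemma likelihoodS n w x : likelihood n.+1 w x = emission x (w 0%N) *
  \sum_(x' : spin) ptrans p x x' * likelihood n (left_shift w) x'.
Proof. by []. Qed.

(** Links the filter to the chain: the joint probability of X_0 = x and the outputs is half the
    likelihood, and also [cyl_prob] times the posterior of x. The induction step is Bayes' rule. *)
Lemma likelihoodE n w :
  likelihood n w spin_pos = 2 * cyl_prob n w * posterior n w 2^-1 /\
  likelihood n w spin_neg = 2 * cyl_prob n w * (1 - posterior n w 2^-1).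
Proof.
elim: n w => [|n IH] w /=; first by split; lra.
have [e1 e2] := IH (left_shift w); rewrite !sum_spin e1 e2 /ptrans /=.
have r01 := posterior_range01 (posterior_range_posterior n (left_shift w) posterior_range_half).
have n0 := next_prob_gt0 (w 0%N) r01.
move: r01 n0; set r := posterior _ _ _ => r01 n0.
rewrite /update; move: (cyl_prob _ _) => c.
have nn : next_prob (w 0%N) r != 0 by rewrite gt_eqF.
split.
  have -> : 2 * (next_prob (w 0%N) r * c) *
    (emission spin_pos (w 0%N) * predict r / next_prob (w 0%N) r) =
    2 * c * emission spin_pos (w 0%N) * predict r *
    (next_prob (w 0%N) r / next_prob (w 0%N) r) by ring.
  by rewrite divff // /predict; ring.
have -> : 2 * (next_prob (w 0%N) r * c) *
    (1 - emission spin_pos (w 0%N) * predict r / next_prob (w 0%N) r) =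
    2 * c * (next_prob (w 0%N) r - emission spin_pos (w 0%N) * predict r *
    (next_prob (w 0%N) r / next_prob (w 0%N) r)) by ring.
by rewrite divff // /next_prob /predict; ring.
Qed.

Lemma ln_lipschitz (c x y : R) : 0 < c -> c <= x -> c <= y ->
  `|ln x - ln y| <= `|x - y| / c.
Proof.
move=> c0; have half (a b : R) : c <= a -> c <= b -> ln a - ln b <= `|a - b| / c.
  move=> ca cb; have a0 := lt_le_trans c0 ca; have b0 := lt_le_trans c0 cb.
  rewrite -ln_div ?posrE // (_ : a / b = 1 + (a - b) / b); last first.
    by rewrite mulrBl divff ?gt_eqF // addrC subrK.
  apply: (@le_trans _ _ ((a - b) / b)).
    apply: le_ln1Dx; rewrite mulrBl divff ?gt_eqF // ltrBrDr addNr.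
    exact: divr_gt0.
  apply: (@le_trans _ _ (`|a - b| / b)).
    by rewrite ler_pM2r ?invr_gt0 // ler_norm.
  by rewrite ler_wpM2l // lef_pV2 ?posrE.
move=> cx cy; rewrite ler_norml half // andbT.
by rewrite lerNl opprB distrC half.
Qed.

Lemma ln_gfun_variation n w w' : agree n w w' ->
  `|ln (gfun w) - ln (gfun w')| <= 2 * gap / rate / m * rate ^+ n.
Proof.
move=> a; have [m0 *] := floor_probP.
have /andP[g1 _] := gfun_bounds w; have /andP[g3 _] := gfun_bounds w'.
apply: le_trans (ln_lipschitz m0 g1 g3) _.
rewrite [leRHS]mulrAC ler_pM2r ?invr_gt0 //; exact: gfun_variation.
Qed.

(** Factor k of [cyl_prob] sees only the n - 1 - k outputs after it, where [gfun] sees the whole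
    tail. The errors form a geometric sum in reverse order, so the first factor matches the last
    power of [rate]. *)
Lemma ln_cyl_prob n w :
  `|ln (cyl_prob n w) - \sum_(k < n) ln (gfun (iter k (@left_shift R) w))|
    <= gap / m * \sum_(k < n) rate ^+ k.
Proof.
have [m0 *] := floor_probP.
elim: n w => [|n IH] w; first by rewrite !big_ord0 /= ln1 subr0 normr0 mulr0.
rewrite big_ord_recl [in leRHS]big_ord_recr /=.
have pr := posterior_range_posterior n (left_shift w) posterior_range_half.
rewrite lnM ?posrE ?cyl_prob_gt0 ?next_prob_gt0 //; last exact: posterior_range01.
rewrite opprD addrACA addrC mulrDr.
apply: le_trans (ler_normD _ _) _; apply: lerD.
  by under eq_bigr do rewrite -iterS iterSr; exact: IH.
have /andP[g1 _] := next_prob_bounds (w 0%N) (posterior_range01 pr).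
have /andP[g2 _] := gfun_bounds w.
apply: le_trans (ln_lipschitz m0 g1 g2) _.
rewrite [leRHS]mulrAC ler_pM2r ?invr_gt0 // distrC.
apply: le_trans (next_prob_diff _ _ _) _.
by apply: lim_posterior_diff => //; exact: posterior_range_half.
Qed.

End filter.

(** * Cylinder probabilities of the hidden Markov process *)

Section law.
Context (R : realType) (p eps : R) (hp : 0 < p < 1) (heps : 0 < eps < 1).
Context (d : measure_display) (T : measurableType d) (P : probability T R).
Context (X Z : nat -> {RV P >-> spin}).
Context (hX : symmetric_chain p X) (hZ : iid_noise eps Z).
Context (hXZ : independent_processes X Z).
Context (Y : nat -> T -> spin).
Context (hY : forall n t, val (Y n t) = val (X n t) * val (Z n t)).

Lemma measurable_RV_eq (V : {RV P >-> spin}) a : measurable [set t | V t = a].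
Proof. by have := @measurable_funPT _ _ _ _ V measurableT [set a] I; rewrite setTI. Qed.

(** The product x y, which is the noise that turns the state x into the output y. *)
Definition flip (x y : spin) : spin := if x == y then spin_pos else spin_neg.

Lemma output_eqP n t y : Y n t = y <-> Z n t = flip (X n t) y.
Proof.
have := hY n t; have [->|->] := spinP (X n t); have [->|->] := spinP (Z n t);
  have [->|->] := spinP y; have [->|->] := spinP (Y n t) => //=.
Qed.

Lemma measurable_output n a : measurable [set t | Y n t = a].
Proof.
have -> : [set t | Y n t = a] =
    \bigcup_(x in [set: spin]) ([set t | X n t = x] `&` [set t | Z n t = flip x a]).
  apply/seteqP; split=> t /=.
    by move/output_eqP => h; exists (X n t).
  by move=> [x _ [/= <- /output_eqP]].
apply: fin_bigcup_measurable; first exact: finite_finset.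
by move=> x _; apply: measurableI; exact: measurable_RV_eq.
Qed.

Definition path_event m (x : nat -> spin) := [set t | forall i, (i <= m)%N -> X i t = x i].

(** States are fixed up to time m inclusive, outputs strictly before n; the path may be shorter than
    the output, and is lengthened by summing over the next state. *)
Definition joint_event m n (x y : nat -> spin) :=
  path_event m x `&` [set t | forall i, (i < n)%N -> Y i t = y i].

Lemma measurable_path_event m x : measurable (path_event m x).
Proof.
have -> : path_event m x = \bigcap_(i in [set i | (i <= m)%N]) [set t | X i t = x i].
  by apply/seteqP; split=> t h i; exact: h.
by apply: bigcap_measurableType => i _; exact: measurable_RV_eq.
Qed.

Lemma measurable_joint_event m n x y : measurable (joint_event m n x y).
Proof.
apply: measurableI; first exact: measurable_path_event.
have -> : [set t | forall i, (i < n)%N -> Y i t = y i] =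
    \bigcap_(i in [set i | (i < n)%N]) [set t | Y i t = y i].
  by apply/seteqP; split=> t h i; exact: h.
by apply: bigcap_measurableType => i _; exact: measurable_output.
Qed.

(** Once the states at all output times are fixed, the outputs prescribe the noise, and independence
    factorises the probability. *)
Lemma joint_event_full m x y : P (joint_event m m.+1 x y) =
  (P (path_event m x) * (\prod_(i < m.+1) emission eps (x i) (y i))%:E)%E.
Proof.
have [indep Zneg Zpos] := hZ.
pose z i := flip (x i) (y i).
have -> : joint_event m m.+1 x y =
    trajectory R X @^-1` (@cylinder R m.+1 x) `&` trajectory R Z @^-1` (@cylinder R m.+1 z).
  apply/seteqP; split=> t [Xx h]; split=> i im.
  - exact: Xx.
  - by rewrite /z -(Xx i im); apply/output_eqP; exact: h.
  - exact: Xx.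
  - by apply/output_eqP; rewrite [X i t](Xx i im); exact: h.
rewrite hXZ; try exact: measurable_cylinder.
congr (_ * _)%E.
have -> : trajectory R Z @^-1` (@cylinder R m.+1 z) =
    [set t | forall j, j \in index_iota 0 m.+1 -> [set z j] (Z j t)].
  apply/seteqP; split=> t h j; first by rewrite mem_index_iota => /h.
  by move=> jm; apply: h; rewrite mem_index_iota.
rewrite (indep _ (fun j => [set z j])) ?iota_uniq // big_mkord -prodEFin.
apply: eq_bigr => i _; rewrite /z /flip /emission.
case: eqP => _; [exact: Zpos|exact: Zneg].
Qed.

Definition extend m (x : nat -> spin) b : nat -> spin :=
  fun i => if (i <= m)%N then x i else b.

Lemma joint_event_split m n x y : joint_event m n x y =
  joint_event m.+1 n (extend m x spin_pos) y `|`
  joint_event m.+1 n (extend m x spin_neg) y.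
Proof.
apply/seteqP; split=> t.
  move=> [Xx Yy]; case: (spinP (X m.+1 t)) => e; [right|left]; split=> // i;
    by rewrite /extend leq_eqVlt ltnS => /predU1P[->|im]; rewrite ?ltnn // im Xx.
by case=> -[Xx Yy]; split=> // i im; rewrite Xx ?(leqW im) // /extend im.
Qed.

Lemma path_event_extend m x b : P (path_event m.+1 (extend m x b)) =
  (P (path_event m x) * (ptrans p (x m) b)%:E)%E.
Proof.
have [_ ->] := hX; rewrite /extend leqnn ltnn; congr (P _ * _)%E.
by apply/seteqP; split=> t h i im; have := h i im; rewrite im.
Qed.

(** Induction on the number j of outputs after time m: revealing the state at time m + 1 lowers it
    by one, down to [joint_event_full]. *)
Lemma joint_event_prob j m x (y : Omega R) : P (joint_event m (m + j.+1) x y) =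
  (P (path_event m x) * (\prod_(i < m) emission eps (x i) (y i) *
     likelihood p eps j.+1 (iter m (@left_shift R) y) (x m))%:E)%E.
Proof.
have shiftE k i : iter k (@left_shift R) y i = y (k + i)%N.
  by elim: k i => //= k IH i; rewrite /left_shift IH addnS.
elim: j m x => [|j IH] m x.
  (* The one-step likelihood ends with a transition to an unobserved state, and these probabilities
     sum to 1. *)
  rewrite addn1 joint_event_full big_ord_recr /= shiftE addn0 sum_spin !mulr1.
  by congr (_ * (_ * _)%:E)%E; case: (spinP (x m)) => ->; rewrite /ptrans /=; ring.
rewrite joint_event_split measureU; try exact: measurable_joint_event; last first.
  apply/seteqP; split=> t // [[h _] [h' _]].
  by have := h m.+1 (leqnn _); rewrite h' // /extend ltnn.
have e : (m + j.+2 = m.+1 + j.+1)%N by rewrite addnS.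
rewrite e; transitivity
  (P (joint_event m.+1 (m.+1 + j.+1) (extend m x spin_pos) y) +
   P (joint_event m.+1 (m.+1 + j.+1) (extend m x spin_neg) y))%E => //.
rewrite !IH !path_event_extend.
have pf : P (path_event m x) \is a fin_num.
  by rewrite fin_num_measure //; exact: measurable_path_event.
rewrite -(fineK pf) -!EFinM -EFinD; congr EFin.
have prodE b : \prod_(i < m.+1) emission eps (extend m x b i) (y i) =
    \prod_(i < m) emission eps (x i) (y i) * emission eps (x m) (y m).
  rewrite big_ord_recr /= /extend leqnn; congr (_ * _).
  by apply: eq_bigr => i _; rewrite ltnW.
rewrite !prodE /extend ltnn [in RHS]likelihoodS shiftE addn0 [in RHS]sum_spin -iterS.
ring.
Qed.

Lemma output_cylinder_prob n (y : Omega R) :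
  P (trajectory R Y @^-1` cylinder n y) = (cyl_prob p eps n y)%:E.
Proof.
case: n => [|n].
  by rewrite (_ : _ @^-1` _ = setT) ?probability_setT //; exact/seteqP.
have -> : trajectory R Y @^-1` cylinder n.+1 y =
   joint_event 0 n.+1 (fun=> spin_pos) y `|` joint_event 0 n.+1 (fun=> spin_neg) y.
  apply/seteqP; split=> t; last by case=> -[_].
  by move=> h; case: (spinP (X 0%N t)) => e; [right|left]; split=> //; case.
rewrite measureU; try exact: measurable_joint_event; last first.
  by apply/seteqP; split=> t // [[h _] [h' _]]; have := h 0%N isT; rewrite h'.
transitivity (P (joint_event 0 (0 + n.+1) (fun=> spin_pos) y) +
    P (joint_event 0 (0 + n.+1) (fun=> spin_neg) y))%E => //.
rewrite !joint_event_prob !big_ord0 !mul1r.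
have p0 x : P (path_event 0 (fun=> x)) = (2^-1)%:E.
  have [hx _] := hX; rewrite -(hx x); congr (P _); apply/seteqP; split=> t; first exact.
  by move=> h [].
rewrite !p0 -!EFinM -EFinD; congr EFin.
(* The two likelihoods add up to twice [cyl_prob], which the initial weights 1/2 cancel. *)
have [-> ->] := likelihoodE hp heps n.+1 y.
by field.
Qed.

End law.

(* The unused proofs are arguments so that the measure structure can be inferred. *)
Definition density_measure (d : measure_display) (T : measurableType d)
    (R : realType) (mu : {measure set T -> \bar R}) (f : T -> R)
    & measurable_fun setT f & (forall t, 0 <= f t) : set T -> \bar R :=
  fun A => (\int[mu]_(t in A) (f t)%:E)%E.

(** * Measures given by a density *)

Section density.
Context (d : measure_display) (T : measurableType d) (R : realType).
Context (mu : {measure set T -> \bar R}) (f : T -> R).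
Context (mf : measurable_fun setT f) (f0 : forall t, 0 <= f t).
Local Notation nu := (density_measure mu mf f0).

Let density0 : nu set0 = 0%E.
Proof. exact: integral_set0. Qed.

Let density_ge0 A : (0 <= nu A)%E.
Proof. by apply: integral_ge0 => t _; rewrite lee_fin. Qed.

Let density_sigma_additive : semi_sigma_additive nu.
Proof.
apply: semi_sigma_additive_nng_induced => [|t]; last by rewrite lee_fin.
exact/measurable_realfun.measurable_EFinP.
Qed.

HB.instance Definition _ := isMeasure.Build _ _ _ nu
  density0 density_ge0 density_sigma_additive.

End density.

(** * Invariance, conditional probabilities and the Gibbs bounds *)

Section gibbs.
Context (R : realType) (p eps : R) (hp : 0 < p < 1) (heps : 0 < eps < 1).
Context (Q : probability (Omega R) R).
Context (Qcyl : forall n w, Q (cylinder n w) = (cyl_prob p eps n w)%:E).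
Local Notation S := (@left_shift R).

Lemma hmm_fully_supported : fully_supported Q.
Proof.
move=> U oU [w Uw].
have [n nU] : exists n, cylinder n w `<=` U.
  by apply: cylinder_sub_nbhs; move: Uw; rewrite openE in oU; exact: oU.
apply: (@lt_le_trans _ _ (Q (cylinder n w))).
  by rewrite Qcyl lte_fin cyl_prob_gt0.
apply: le_measure nU; rewrite inE; first exact: measurable_cylinder.
exact: sub_sigma_algebra.
Qed.

Lemma cylinder_scons n a (w : Omega R) :
  S @^-1` cylinder n w `&` [set v | v 0%N = a] = cylinder n.+1 (scons a w).
Proof.
apply/seteqP; split=> v.
  by move=> [h h0] [|i] //= ni; exact: h.
by move=> h; split; [move=> i ni; exact: (h i.+1)|exact: (h 0%N)].
Qed.

Lemma cyl_prob_scons n a (w : Omega R) : cyl_prob p eps n.+1 (scons a w) =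
  next_prob p eps a (posterior p eps n w 2^-1) * cyl_prob p eps n w.
Proof. by []. Qed.

Lemma measure_preimage_shift_cylinder n w : Q (S @^-1` cylinder n w) = Q (cylinder n w).
Proof.
have -> : S @^-1` cylinder n w =
    cylinder n.+1 (scons spin_pos w) `|` cylinder n.+1 (scons spin_neg w).
  rewrite -!cylinder_scons -setIUr; apply/esym/setIidPl => v _.
  by case: (spinP (v 0%N)); [right|left].
rewrite measureU; try exact: measurable_cylinder; last first.
  by apply/seteqP; split=> v // [/(_ 0%N isT)/= e /(_ 0%N isT)/=]; rewrite e.
transitivity (Q (cylinder n.+1 (scons spin_pos w)) + Q (cylinder n.+1 (scons spin_neg w)))%E => //.
rewrite !Qcyl -EFinD !cyl_prob_scons -mulrDl.
have := @sum_next_prob R p eps (posterior p eps n w 2^-1).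
by rewrite sum_spin => ->; rewrite mul1r.
Qed.

Lemma hmm_translation_invariant : translation_invariant Q.
Proof.
move=> B mB.
have mS := @measurable_left_shift R.
apply: (@measure_eq_on_cylinders _ (pushforward Q S) Q) => //.
- have : (Q setT < +oo)%E by rewrite probability_setT ltry.
  exact.
- exact: measure_preimage_shift_cylinder.
Qed.

(** This is g(a, w) as a function of w; composed with the shift it is the candidate conditional
    probability of w_0 = a. *)
Definition tail_density (a : spin) (w : Omega R) : R := next_prob p eps a (lim_posterior p eps w).

Lemma tail_density_bounds a w : 0 <= tail_density a w <= 1.
Proof.
have /andP[h1 h2] := next_prob_bounds hp heps a
  (posterior_range01 hp heps (posterior_range_lim hp heps w)).
by have [m0 *] := floor_probP hp heps; rewrite /tail_density; apply/andP; split; lra.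
Qed.

Lemma tail_density_variation a :
  exp_variation (tail_density a) (2 * gap p eps) (rate p).
Proof.
move=> n w w' h; apply: le_trans (next_prob_diff hp heps _ _ _) _.
exact: lim_posterior_variation.
Qed.

Lemma continuous_tail_density a : continuous (tail_density a).
Proof.
apply: (exp_variation_continuous _ (@tail_density_variation a)).
by have /andP[? ?] := rateP hp; apply/andP; split => //; lra.
Qed.

Lemma measurable_tail_density a : measurable_fun setT (tail_density a).
Proof. by apply: continuous_measurable_Omega; exact: continuous_tail_density. Qed.

Lemma integrable_tail_density a (A : set (Omega R)) : measurable A ->
  Q.-integrable A (EFin \o tail_density a).
Proof.
move=> mA; apply: measurable_bounded_integrable => //.
- exact: le_lt_trans (probability_le1 _ mA) (ltry _).
- by apply: measurable_funTS; exact: measurable_tail_density.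
- exists 1; split=> // x x1 w _ /=; apply/ltW; apply: le_lt_trans x1.
  by have /andP[? ?] := tail_density_bounds a w; rewrite ger0_norm.
Qed.

Let mcoord a : measurable [set w : Omega R | w 0%N = a] := measurable_coordinate 0 a.

(** On the cylinder the density is within gap * rate^n of the constant
    [next_prob a (posterior n w 2^-1)], whose integral is exactly the probability of the word
    preceded by a. *)
Lemma tail_density_cylinder a n w :
  `|fine (\int[Q]_(v in cylinder n w) (tail_density a v)%:E)%E -
    cyl_prob p eps n.+1 (scons a w)| <= gap p eps * rate p ^+ n * cyl_prob p eps n w.
Proof.
have mc := measurable_cylinder n w.
have int_cst c : (\int[Q]_(v in cylinder n w) c%:E)%E = (c * cyl_prob p eps n w)%:E.
  transitivity (c%:E * Q (cylinder n w))%E; [exact: integral_cst|by rewrite Qcyl].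
have icst c : Q.-integrable (cylinder n w) (EFin \o cst c).
  apply: measurable_bounded_integrable => //; last exact: bounded_cst.
  exact: le_lt_trans (probability_le1 _ mc) (ltry _).
have itd := integrable_tail_density a mc.
have fin := integrable_fin_num mc itd.
rewrite cyl_prob_scons; set c := next_prob _ _ _ _; set e := gap _ _ * _.
have close v : cylinder n w v -> `|tail_density a v - c| <= e.
  move=> vw; apply: le_trans (next_prob_diff hp heps _ _ _) _.
  apply: lim_posterior_diff => //; exact: posterior_range_half.
have up :
    (\int[Q]_(v in cylinder n w) (tail_density a v)%:E <= ((c + e) * cyl_prob p eps n w)%:E)%E.
  rewrite -int_cst; apply: le_integral => // [|v]; first exact: icst.
  by rewrite inE => /close; rewrite lee_fin ler_norml => /andP[]; lra.
have lo :
    (((c - e) * cyl_prob p eps n w)%:E <= \int[Q]_(v in cylinder n w) (tail_density a v)%:E)%E.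
  rewrite -int_cst; apply: le_integral => // [|v]; first exact: icst.
  by rewrite inE => /close; rewrite lee_fin ler_norml => /andP[]; lra.
move: up lo; rewrite -(fineK fin) !lee_fin ler_norml => up lo.
by apply/andP; split; lra.
Qed.

Lemma tail_density_integral a (B : set (Omega R)) : measurable B ->
  (\int[Q]_(v in B) (tail_density a v)%:E)%E = Q (S @^-1` B `&` [set v | v 0%N = a]).
Proof.
move=> mB; have mS := @measurable_left_shift R.
have td0 v : 0 <= tail_density a v by have /andP[] := tail_density_bounds a v.
have [rho0 rho1] : 0 <= rate p /\ rate p < 1.
  by have /andP[? ?] := rateP hp; split => //; lra.
have Qfin (A : set (Omega R)) : measurable A -> (Q A < +oo)%E.
  by move=> mA; exact: le_lt_trans (probability_le1 _ mA) (ltry _).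
(* Both sides are finite measures in B, and [tail_density_cylinder] is the closeness that forces
   them to be equal. *)
pose m1 : {measure set (Omega R) -> \bar R} :=
  density_measure Q (measurable_tail_density a) td0.
pose m2 : {measure set (Omega R) -> \bar R} := pushforward (mrestr Q (mcoord a)) S.
change (m1 B = m2 mS B).
apply: (@measure_eq_of_close_on_cylinders _ m1 (m2 mS) Q (gap p eps) (rate p)) => //.
- have := integrable_fin_num measurableT (integrable_tail_density a measurableT).
  by rewrite ge0_fin_numE //; exact: (measure_ge0 m1 setT).
- by apply: Qfin; rewrite preimage_setT setTI.
- exact: Qfin.
- by apply/andP.
- move=> n w; have := tail_density_cylinder a n w.
  rewrite -[cyl_prob _ _ n w]/(fine (cyl_prob p eps n w)%:E) -Qcyl.
  by rewrite -[cyl_prob _ _ _ _]/(fine (cyl_prob p eps n.+1 (scons a w))%:E) -Qcyl -cylinder_scons.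
Qed.

Lemma hmm_cond_prob a : is_cond_prob Q (@tail_sigma R) [set w | w 0%N = a]
  (tail_density a \o S).
Proof.
have mtd := measurable_tail_density a; have mS := @measurable_left_shift R.
split.
- move=> B mB; apply: (@preimage_tail_sigma _ (tail_density a @^-1` B)).
  by have := mtd measurableT B mB; rewrite setTI.
- apply: measurable_bounded_integrable => //.
  + exact: le_lt_trans (probability_le1 _ measurableT) (ltry _).
  + exact: measurableT_comp.
  + exists 1; split=> // x x1 w _ /=; apply/ltW; apply: le_lt_trans x1.
    by have /andP[? ?] := tail_density_bounds a (S w); rewrite ger0_norm.
- move=> _ /tail_sigma_preimage[B mB ->].
  rewrite setIC -tail_density_integral //.
  (* Change of variables along the shift; invariance then replaces the image of Q by Q itself. *)
  rewrite -(@ge0_integral_pushforward _ _ _ _ _ _ mS Q B (EFin \o tail_density a)) //.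
  + apply: eq_measure_integral => A mA _; exact: hmm_translation_invariant.
  + by apply/measurable_realfun.measurable_EFinP; exact: measurable_funTS.
  + by move=> v _; rewrite lee_fin; have /andP[] := tail_density_bounds a v.
Qed.

Local Notation g := (gfun p eps).

Lemma gfun_exp_variation : exp_variation g (2 * gap p eps / rate p) (rate p).
Proof. by move=> n w w'; exact: gfun_variation. Qed.

Lemma hmm_g_function : g_function g.
Proof.
split.
- apply: (exp_variation_continuous _ gfun_exp_variation).
  by have /andP[? ?] := rateP hp; apply/andP; split => //; lra.
- move=> w; have /andP[h1 h2] := gfun_bounds hp heps w.
  by have [m0 *] := floor_probP hp heps; apply/andP; split; lra.
- move=> w; rewrite -[RHS](@sum_next_prob R p eps (lim_posterior p eps (S w))).
  exact: eq_bigr.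
Qed.

Lemma hmm_is_g_measure : is_g_measure Q g.
Proof.
split; [exact: hmm_fully_supported|exact: hmm_translation_invariant|exact: hmm_g_function|].
exists (fun a => tail_density a \o S); split; first exact: hmm_cond_prob.
(* The two functions coincide at every point, by unfolding [gfun]. *)
exact: aeW.
Qed.

Local Notation phi := (fun w => ln (g w)).

Lemma ln_gfun_exp_variation :
  exp_variation phi (2 * gap p eps / rate p / floor_prob p eps) (rate p).
Proof. by move=> n w w'; exact: ln_gfun_variation. Qed.

Lemma hmm_bowen_gibbs : bowen_gibbs Q phi.
Proof.
have [m0 *] := floor_probP hp heps.
have /andP[r2 r1] := rateP hp; have r0 := rate_gt0 hp.
(* The bound of [ln_cyl_prob] with the full geometric series in place of its partial sum. *)
pose K := gap p eps / floor_prob p eps / (1 - rate p).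
have K0 : 0 <= K.
  by rewrite !divr_ge0 // ?subr_ge0; apply/ltW => //; exact: gap_gt0.
split; [exact: hmm_fully_supported|exact: hmm_translation_invariant| |].
  apply: (exp_variation_continuous _ ln_gfun_exp_variation).
  by rewrite r1 ltW.
(* The pressure is 0 because g is normalised. *)
exists 0, (expR K); split; first by rewrite -expR0 ler_expR.
move=> w n _; rewrite (Qcyl n w : Q [set w' | agree n w' w] = _) /= mulr0 subr0.
have c0 := cyl_prob_gt0 hp heps n w.
rewrite -(lnK (x := cyl_prob p eps n w)) ?posrE // -expRN -expRB !ler_expR -ler_norml.
apply: le_trans (ln_cyl_prob hp heps n w) _.
apply: ler_wpM2l.
  by rewrite divr_ge0 // ltW // gap_gt0.
have -> : \sum_(k < n) rate p ^+ k = series (geometric 1 (rate p)) n.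
  by rewrite /series /= big_mkord; apply: eq_bigr => k _; rewrite mul1r.
by rewrite -[leRHS]mul1r; apply: geometric_le_lim => //; rewrite ger0_norm // ltW.
Qed.

End gibbs.

(** * Both properties for the law of the output process *)

Theorem theorem3p1 (R : realType) (p eps : R) (hp : 0 < p < 1)
  (heps : 0 < eps < 1)
  (d : measure_display) (T : measurableType d) (P : probability T R)
  (X Z : nat -> {RV P >-> spin})
  (hX : symmetric_chain p X) (hZ : iid_noise eps Z)
  (hXZ : independent_processes X Z)
  (Y : nat -> T -> spin)
  (hY : forall (n : nat) (t : T), val (Y n t) = val (X n t) * val (Z n t))
  (Q : probability (Omega R) R) (hQ : is_law P Y Q) :
  (exists g : Omega R -> R, is_g_measure Q g /\
     exists C rho : R, [/\ 0 < C, 0 < rho < 1 &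
       forall n : nat, (1 <= n)%N -> (var_n n g <= (C * rho ^+ n)%:E)%E]) /\
  (exists phi : Omega R -> R, hoelder_continuous phi /\ bowen_gibbs Q phi).
Proof.
have Qcyl n w : Q (cylinder n w) = (cyl_prob p eps n w)%:E.
  rewrite hQ; last exact: measurable_cylinder.
  exact: (output_cylinder_prob hp heps hX hZ hXZ hY).
have [r2 r1] := andP (rateP hp); have r0 := rate_gt0 hp.
split.
  exists (gfun p eps); split; first exact: hmm_is_g_measure.
  exists (2 * gap p eps / rate p), (rate p); split.
  - by rewrite divr_gt0 // mulr_gt0 // gap_gt0.
  - by rewrite r0.
  - move=> n _; apply: ge_ereal_sup => _ [w [w' [ww' ->]]].
    by rewrite lee_fin; exact: gfun_exp_variation.
exists (fun w => ln (gfun p eps w)); split; last exact: hmm_bowen_gibbs.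
apply: exp_variation_hoelder (ln_gfun_exp_variation hp heps).
by rewrite r2 r1.
Qed.
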